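(* Let $\alpha,\delta$ be real numbers with $\delta\ne0$ and $\alpha\neq\frac12$, and let $A=E_{-1,\alpha,\delta}(\mathbb{H})$, which is a noncommutative Jordan algebra. Then $\mathrm{Der}(A)\cong\mathrm{Der}(\mathbb{H})\cong su(2)$. Moreover, putting $f=(0,1)$ and identifying $x\in\mathbb{H}$ with $(x,0)\in A$, the subspaces $\mathrm{span}\{1\}$, $\mathrm{span}\{f\}$, $\mathrm{span}\{i,j,k\}$ and $\mathrm{span}\{if,jf,kf\}$ are irreducible $\mathrm{Der}(A)$-submodules of $A$, and $A$ is their direct sum. If in addition $\alpha>\frac12$ and $(2\alpha-1)\delta^2<4$, then $A$ is a linear division algebra. In particular, there exists a real (noncommutative Jordan) linear division algebra of dimension $8$ whose Lie algebra of derivations is $su(2)$ and which decomposes into irreducible $su(2)$-modules of dimensions $1,1,3,3$.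
   Context: Algebras are vector spaces with a bilinear product, not assumed associative. $(x,y,z)=(xy)z-x(yz)$. An algebra is noncommutative Jordan if $(x,y,x)=0$ and $(x^2,y,x)=0$ for all $x,y$. An algebra $A\neq\{0\}$ is a linear division algebra if for every nonzero $x$ the maps $y\mapsto xy$ and $y\mapsto yx$ are bijective. $\mathrm{Der}(A)$ is the Lie algebra of linear maps $\partial:A\to A$ with $\partial(xy)=(\partial x)y+x\,\partial y$, with bracket $[f,g]=fg-gf$; it acts on $A$ in the obvious way. $\mathbb{H}$ is the real quaternion algebra with basis $1,i,j,k$ and usual conjugation $x\mapsto\overline{x}$. $E_{-1,\alpha,\delta}(\mathbb{H})$ is the real vector space $\mathbb{H}\times\mathbb{H}$ with product $(x,y)(x',y')=\big(\alpha xx'+(1-\alpha)x'x-\overline{y'}y,\ y\overline{x'}+y'x+\tfrac{\delta}{2}(y'y-yy')\big)$. *)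

(* Defs.v *)
From HB Require Import structures.
From mathcomp Require Import all_boot all_order all_algebra.
From mathcomp Require Import boolp reals.
From mathcomp Require Import complex.
From mathcomp Require Import ring.

Set Implicit Arguments.
Unset Strict Implicit.
Unset Printing Implicit Defensive.

Import GRing.Theory.

Local Open Scope ring_scope.

(* Algebras are finite-dimensional, since the carrier is a vectType; neither  *)
(* associativity nor a unit is assumed.                                       *)

HB.mixin Record isNonAssocAlgebra (R : fieldType) A of Vector R A := {
  amul : A -> A -> A;
  amul_linearl : forall y, linear (fun x => amul x y);
  amul_linearr : forall x, linear (amul x)
}.

#[short(type="naAlgType")]
HB.structure Definition NonAssocAlgebra (R : fieldType) :=
  { A of Vector R A & isNonAssocAlgebra R A }.

Notation "x ** y" := (amul x y) (at level 40, left associativity) : ring_scope.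

Section NonAssocAlgebraTheory.
Context {R : fieldType} {A : naAlgType R}.
Implicit Types x y z : A.

Lemma amulDl x y z : (x + y) ** z = x ** z + y ** z.
Proof. by have := amul_linearl z 1 x y; rewrite !scale1r. Qed.

Lemma amulDr x y z : x ** (y + z) = x ** y + x ** z.
Proof. by have := amul_linearr x 1 y z; rewrite !scale1r. Qed.

Lemma amul0 x : x ** 0 = 0.
Proof. by apply: (addrI (x ** 0)); rewrite -amulDr !addr0. Qed.

Lemma a0mul x : 0 ** x = 0.
Proof. by apply: (addrI (0 ** x)); rewrite -amulDl !addr0. Qed.

Lemma amulZl a x y : (a *: x) ** y = a *: (x ** y).
Proof. by have := amul_linearl y a x 0; rewrite a0mul !addr0. Qed.

Lemma amulZr a x y : x ** (a *: y) = a *: (x ** y).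
Proof. by have := amul_linearr x a y 0; rewrite amul0 !addr0. Qed.

Lemma amulNl x y : (- x) ** y = - (x ** y).
Proof. by rewrite -scaleN1r amulZl scaleN1r. Qed.

Lemma amulNr x y : x ** (- y) = - (x ** y).
Proof. by rewrite -scaleN1r amulZr scaleN1r. Qed.

Definition associator x y z : A := (x ** y) ** z - x ** (y ** z).

End NonAssocAlgebraTheory.

Definition noncommutative_jordan (R : fieldType) (A : naAlgType R) : Prop :=
  forall x y : A, associator x y x = 0 /\ associator (x ** x) y x = 0.

Definition linear_division_algebra (R : fieldType) (A : naAlgType R) : Prop :=
  (exists x : A, x != 0) /\
  forall x : A, x != 0 ->
    bijective (fun y => x ** y) /\ bijective (fun y => y ** x).

HB.mixin Record isLieAlgebra (R : fieldType) L of GRing.Lmodule R L := {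
  lie : L -> L -> L;
  lie_linearl : forall y, linear (fun x => lie x y);
  lie_linearr : forall x, linear (lie x);
  lie_alt : forall x, lie x x = 0;
  lie_jacobi : forall x y z,
    lie x (lie y z) + lie y (lie z x) + lie z (lie x y) = 0
}.

#[short(type="lieAlgType")]
HB.structure Definition LieAlgebra (R : fieldType) :=
  { L of GRing.Lmodule R L & isLieAlgebra R L }.

Definition lie_isomorphism (R : fieldType) (L L' : lieAlgType R)
    (phi : {linear L -> L'}) : Prop :=
  bijective phi /\ forall x y, phi (lie x y) = lie (phi x) (phi y).

Definition lie_isomorphic (R : fieldType) (L L' : lieAlgType R) : Prop :=
  exists phi : {linear L -> L'}, lie_isomorphism phi.

(* Here [rho] is meant to be a representation of L on V; no proof of this is  *)
(* carried along.                                                             *)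
Definition lie_submodule (R : fieldType) (L : lieAlgType R) (V : vectType R)
    (rho : L -> 'End(V)) (W : {vspace V}) : Prop :=
  forall d : L, (rho d @: W <= W)%VS.

Definition irreducible_submodule (R : fieldType) (L : lieAlgType R)
    (V : vectType R) (rho : L -> 'End(V)) (W : {vspace V}) : Prop :=
  [/\ lie_submodule rho W, W != 0%VS &
      forall U : {vspace V}, (U <= W)%VS -> lie_submodule rho U ->
        U = 0%VS \/ U = W].

Fact commutator_jacobi (V : zmodType) (op : V -> V -> V) :
  associative op -> right_distributive op (fun x y => x - y) ->
  left_distributive op (fun x y => x - y) ->
  let br x y := op x y - op y x in
  forall x y z, br x (br y z) + br y (br z x) + br z (br x y) = 0.
Proof.
move=> opA opBr opBl br x y z; rewrite /br !(opBr, opBl) !opA !opprB.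
rewrite (AC ((2*2)*(2*2)*(2*2))%AC
  ((1*12)*(7*2)*(5*4)*(3*10)*(11*6)*(9*8))%AC).
by rewrite /= !subrr !addr0.
Qed.

Section Derivations.
Context {R : fieldType} (A : naAlgType R).

Definition derivation : {pred 'End(A)} :=
  fun d => `[< forall x y : A, d (x ** y) = d x ** y + x ** d y >].

Fact derivation_submod_closed : submod_closed derivation.
Proof.
split=> [|a f g /asboolP fD /asboolP gD]; apply/asboolP => x y.
  by rewrite !lfunE /= amul0 a0mul addr0.
rewrite !(add_lfunE, scale_lfunE) fD gD !(amulDl, amulDr, amulZl, amulZr).
by rewrite scalerDr addrACA.
Qed.

HB.instance Definition _ :=
  GRing.isSubmodClosed.Build R 'End(A) derivation derivation_submod_closed.

Record Der := MkDer { der_fun : 'End(A); _ : der_fun \in derivation }.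

HB.instance Definition _ := [isSub for der_fun].
HB.instance Definition _ := [Choice of Der by <:].
HB.instance Definition _ := [SubChoice_isSubZmodule of Der by <:].
HB.instance Definition _ := [SubZmodule_isSubLmodule of Der by <:].

Fact der_bracket_proof (f g : Der) :
  ((der_fun f \o der_fun g) - (der_fun g \o der_fun f))%VF \in derivation.
Proof.
case: f g => [f /asboolP fD] [g /asboolP gD] /=; apply/asboolP => x y.
rewrite !(add_lfunE, opp_lfunE, comp_lfunE) gD fD !linearD /= !fD !gD.
rewrite !(amulDl, amulDr, amulNl, amulNr) !opprD.
rewrite [LHS](AC ((2*2)*(2*2))%AC ((1*5)*(4*8)*((2*7)*(3*6)))%AC) /=.
by rewrite !subrr !addr0.
Qed.

Definition der_bracket (f g : Der) : Der := MkDer (der_bracket_proof f g).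

Fact der_bracket_linearl g : linear (fun f => der_bracket f g).
Proof.
move=> a f h; apply: val_inj; rewrite /= comp_lfunDl comp_lfunDr.
by rewrite -comp_lfunZl -comp_lfunZr scalerBr opprD addrACA.
Qed.

Fact der_bracket_linearr f : linear (der_bracket f).
Proof.
move=> a g h; apply: val_inj; rewrite /= comp_lfunDl comp_lfunDr.
by rewrite -comp_lfunZl -comp_lfunZr scalerBr opprD addrACA.
Qed.

Fact der_bracket_alt f : der_bracket f f = 0.
Proof. by apply: val_inj; rewrite /= subrr. Qed.

Fact der_bracket_jacobi f g h :
  der_bracket f (der_bracket g h) + der_bracket g (der_bracket h f)
  + der_bracket h (der_bracket f g) = 0.
Proof.
apply: val_inj => /=.
apply: (commutator_jacobi (op := @comp_lfun _ _ _ _)) => {}f {}g {}h.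
- exact: comp_lfunA.
- by rewrite comp_lfunDr comp_lfunNr.
- by rewrite comp_lfunDl comp_lfunNl.
Qed.

HB.instance Definition _ := isLieAlgebra.Build R Der
  der_bracket_linearl der_bracket_linearr der_bracket_alt der_bracket_jacobi.

End Derivations.

(* su(n), the trace-free skew-Hermitian complex matrices, is a Lie algebra    *)
(* over R only; 'M[R[i]]_n has no canonical R-module structure, so the real   *)
(* scaling is set up on su directly.                                          *)

Section SpecialUnitary.
Context (R : rcfType) (n : nat).
Implicit Types X Y Z : 'M[R[i]]_n.

Definition adjmx X : 'M[R[i]]_n := (map_mx (@conjc R) X)^T.

Definition skew_hermitian0 : {pred 'M[R[i]]_n} :=
  fun X => (adjmx X == - X) && (\tr X == 0).

Fact adjmxB X Y : adjmx (X - Y) = adjmx X - adjmx Y.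
Proof. by rewrite /adjmx map_mxB linearB. Qed.

Fact adjmxM X Y : adjmx (X *m Y) = adjmx Y *m adjmx X.
Proof. by rewrite /adjmx map_mxM trmx_mul. Qed.

Fact adjmxZ (a : R) X : adjmx (a%:C%C *: X) = a%:C%C *: adjmx X.
Proof. by rewrite /adjmx map_mxZ linearZ /= oppr0. Qed.

Lemma skew_hermitian0P X :
  reflect (adjmx X = - X /\ \tr X = 0) (X \in skew_hermitian0).
Proof. exact: (andPP eqP eqP). Qed.

Fact skew_hermitian0_zmod_closed : zmod_closed skew_hermitian0.
Proof.
split=> [|X Y /skew_hermitian0P[hX tX] /skew_hermitian0P[hY tY]];
  apply/skew_hermitian0P; split.
- by rewrite /adjmx map_mx0 trmx0 oppr0.
- exact: mxtrace0.
- by rewrite adjmxB hX hY opprD.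
- by rewrite linearB /= tX tY subrr.
Qed.

HB.instance Definition _ := GRing.isZmodClosed.Build 'M[R[i]]_n
  skew_hermitian0 skew_hermitian0_zmod_closed.

Record su := MkSu { su_mx : 'M[R[i]]_n; _ : su_mx \in skew_hermitian0 }.

HB.instance Definition _ := [isSub for su_mx].
HB.instance Definition _ := [Choice of su by <:].
HB.instance Definition _ := [SubChoice_isSubZmodule of su by <:].

Fact su_scale_proof (a : R) (X : su) :
  a%:C%C *: su_mx X \in skew_hermitian0.
Proof.
case: X => X /= /skew_hermitian0P[hX tX]; apply/skew_hermitian0P.
by rewrite adjmxZ hX scalerN mxtraceZ tX mulr0.
Qed.

Definition su_scale (a : R) (X : su) : su := MkSu (su_scale_proof a X).

Implicit Types u v w : su.

Fact su_scaleA a b u : su_scale a (su_scale b u) = su_scale (a * b) u.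
Proof. by apply: val_inj; rewrite /= scalerA rmorphM. Qed.

Fact su_scale1 : left_id 1 su_scale.
Proof. by move=> u; apply: val_inj; rewrite /= scale1r. Qed.

Fact su_scaleDr : right_distributive su_scale +%R.
Proof. by move=> a u v; apply: val_inj; rewrite /= scalerDr. Qed.

Fact su_scaleDl u : {morph su_scale^~ u : a b / a + b}.
Proof. by move=> a b; apply: val_inj; rewrite /= rmorphD scalerDl. Qed.

HB.instance Definition _ := GRing.Zmodule_isLmodule.Build R su
  su_scaleA su_scale1 su_scaleDr su_scaleDl.

Fact su_bracket_proof (u v : su) :
  su_mx u *m su_mx v - su_mx v *m su_mx u \in skew_hermitian0.
Proof.
case: u v => [u /skew_hermitian0P[hX _]] [v /skew_hermitian0P[hY _]] /=.
apply/skew_hermitian0P; rewrite adjmxB !adjmxM hX hY !(mulNmx, mulmxN) !opprK.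
by rewrite opprB linearB /= mxtrace_mulC subrr.
Qed.

Definition su_bracket (u v : su) : su := MkSu (su_bracket_proof u v).

Fact su_bracket_linearl v : linear (su_bracket^~ v).
Proof.
move=> a u w; apply: val_inj; rewrite /= mulmxDl mulmxDr.
by rewrite -scalemxAl -scalemxAr scalerBr opprD addrACA.
Qed.

Fact su_bracket_linearr u : linear (su_bracket u).
Proof.
move=> a v w; apply: val_inj; rewrite /= mulmxDl mulmxDr.
by rewrite -scalemxAl -scalemxAr scalerBr opprD addrACA.
Qed.

Fact su_bracket_alt u : su_bracket u u = 0.
Proof. by apply: val_inj; rewrite /= subrr. Qed.

Fact su_bracket_jacobi u v w :
  su_bracket u (su_bracket v w) + su_bracket v (su_bracket w u)
  + su_bracket w (su_bracket u v) = 0.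
Proof.
apply: val_inj => /=; apply: (commutator_jacobi (op := @mulmx _ _ _ _)).
- exact: mulmxA.
- exact: mulmxBr.
- by move=> {}u {}v {}w; exact: mulmxBl.
Qed.

HB.instance Definition _ := isLieAlgebra.Build R su
  su_bracket_linearl su_bracket_linearr su_bracket_alt su_bracket_jacobi.

End SpecialUnitary.

Record quat (R : Type) :=
  Quat { quat_re : R; quat_im_i : R; quat_im_j : R; quat_im_k : R }.

Section Quaternions.
Context (R : fieldType).
Local Notation H := (quat R).
Implicit Types x y z : H.

Definition quat_to_row x : 'rV[R]_4 :=
  \row_j [:: quat_re x; quat_im_i x; quat_im_j x; quat_im_k x]`_j.
Definition row_to_quat (v : 'rV[R]_4) : H :=
  Quat (v 0 (inord 0)) (v 0 (inord 1)) (v 0 (inord 2)) (v 0 (inord 3)).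

Fact quat_to_rowK : cancel quat_to_row row_to_quat.
Proof. by case=> a b c d; rewrite /row_to_quat !mxE !inordK. Qed.

Fact row_to_quatK : cancel row_to_quat quat_to_row.
Proof.
move=> v; apply/rowP => j; rewrite mxE /=.
by case: j => [[|[|[|[|//]]]]] ltj /=; congr (v _ _); apply: val_inj;
  rewrite /= inordK.
Qed.

HB.instance Definition _ := Choice.copy H (can_type quat_to_rowK).

Definition quat_add x y : H :=
  Quat (quat_re x + quat_re y) (quat_im_i x + quat_im_i y)
       (quat_im_j x + quat_im_j y) (quat_im_k x + quat_im_k y).
Definition quat_opp x : H :=
  Quat (- quat_re x) (- quat_im_i x) (- quat_im_j x) (- quat_im_k x).
Definition quat_scale (a : R) x : H :=
  Quat (a * quat_re x) (a * quat_im_i x) (a * quat_im_j x) (a * quat_im_k x).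
Definition quat_mul x y : H :=
  let: Quat a b c d := x in
  let: Quat a' b' c' d' := y in
  Quat (a * a' - b * b' - c * c' - d * d')
       (a * b' + b * a' + c * d' - d * c')
       (a * c' - b * d' + c * a' + d * b')
       (a * d' + b * c' - c * b' + d * a').
Definition quat_conj x : H :=
  Quat (quat_re x) (- quat_im_i x) (- quat_im_j x) (- quat_im_k x).

Local Ltac quat_ring :=
  repeat case=> ? ? ? ?;
  rewrite /quat_mul /quat_add /quat_opp /quat_scale /=;
  congr Quat; ring.

Fact quat_addA : associative quat_add. Proof. quat_ring. Qed.
Fact quat_addC : commutative quat_add. Proof. quat_ring. Qed.
Fact quat_add0 : left_id (Quat 0 0 0 0) quat_add. Proof. quat_ring. Qed.
Fact quat_addN : left_inverse (Quat 0 0 0 0) quat_opp quat_add.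
Proof. quat_ring. Qed.

HB.instance Definition _ :=
  GRing.isZmodule.Build H quat_addA quat_addC quat_add0 quat_addN.

Fact quat_mulA : associative quat_mul. Proof. quat_ring. Qed.
Fact quat_mul1 : left_id (Quat 1 0 0 0) quat_mul. Proof. quat_ring. Qed.
Fact quat_1mul : right_id (Quat 1 0 0 0) quat_mul. Proof. quat_ring. Qed.
Fact quat_mulDl : left_distributive quat_mul quat_add. Proof. quat_ring. Qed.
Fact quat_mulDr : right_distributive quat_mul quat_add. Proof. quat_ring. Qed.
Fact quat_1neq0 : Quat 1 0 0 0 != 0 :> H.
Proof. by apply/eqP => -[] /eqP; rewrite oner_eq0. Qed.

HB.instance Definition _ := GRing.Zmodule_isNzRing.Build H
  quat_mulA quat_mul1 quat_1mul quat_mulDl quat_mulDr quat_1neq0.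

Fact quat_scaleA a b x : quat_scale a (quat_scale b x) = quat_scale (a * b) x.
Proof. by move: x; quat_ring. Qed.
Fact quat_scale1 : left_id 1 quat_scale. Proof. quat_ring. Qed.
Fact quat_scaleDr : right_distributive quat_scale quat_add.
Proof. by move=> a; quat_ring. Qed.
Fact quat_scaleDl x a b :
  quat_scale (a + b) x = quat_add (quat_scale a x) (quat_scale b x).
Proof. by move: x; quat_ring. Qed.

HB.instance Definition _ := GRing.Zmodule_isLmodule.Build R H
  quat_scaleA quat_scale1 quat_scaleDr quat_scaleDl.

Fact quat_scaleAl (a : R) x y :
  quat_scale a (quat_mul x y) = quat_mul (quat_scale a x) y.
Proof. by move: x y; quat_ring. Qed.
HB.instance Definition _ := GRing.Lmodule_isLalgebra.Build R H quat_scaleAl.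

Fact quat_scaleAr (a : R) x y :
  quat_scale a (quat_mul x y) = quat_mul x (quat_scale a y).
Proof. by move: x y; quat_ring. Qed.
HB.instance Definition _ := GRing.Lalgebra_isAlgebra.Build R H quat_scaleAr.

Fact quat_vector_axiom : Vector.axiom 4 H.
Proof.
exists quat_to_row; last by exists row_to_quat;
  [exact: quat_to_rowK | exact: row_to_quatK].
by move=> a x y; apply/rowP => -[[|[|[|[|//]]]]] ltj; rewrite !mxE.
Qed.
HB.instance Definition _ := Lmodule_hasFinDim.Build R H quat_vector_axiom.

Fact quat_mul_linearl y : linear (fun x : H => x * y).
Proof. by move=> a x z; rewrite mulrDl scalerAl. Qed.
Fact quat_mul_linearr x : linear (fun y : H => x * y).
Proof. by move=> a y z; rewrite mulrDr scalerAr. Qed.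
HB.instance Definition _ :=
  isNonAssocAlgebra.Build R H quat_mul_linearl quat_mul_linearr.

Fact quat_conj_is_linear : linear quat_conj.
Proof. by move=> a [? ? ? ?] [? ? ? ?]; congr Quat => /=; ring. Qed.
HB.instance Definition _ :=
  GRing.isLinear.Build R H H *:%R quat_conj quat_conj_is_linear.

Definition quat_i : H := Quat 0 1 0 0.
Definition quat_j : H := Quat 0 0 1 0.
Definition quat_k : H := Quat 0 0 0 1.

End Quaternions.

Arguments quat_i {R}.
Arguments quat_j {R}.
Arguments quat_k {R}.

(* E_{-1,alpha,delta}(H). The parameters alpha and delta are not used in the  *)
(* carrier; they select the product E_mul.                                    *)
Definition E_algebra (R : fieldType) (alpha delta : R) : Type :=
  (quat R * quat R)%type.

Section EAlgebra.
Context (R : fieldType) (alpha delta : R).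
Local Notation E := (E_algebra alpha delta).

HB.instance Definition _ := Vector.copy E (quat R * quat R)%type.

Definition E_mul (u v : E) : E :=
  let: (x, y) := u in
  let: (x', y') := v in
  (alpha *: (x * x') + (1 - alpha) *: (x' * x) - quat_conj y' * y,
   y * quat_conj x' + y' * x + (delta / 2%:R) *: (y' * y - y * y')).

Fact E_mul_linearl v : linear (fun u => E_mul u v).
Proof.
move: v => [[? ? ? ?] [? ? ? ?]] a [[? ? ? ?] [? ? ? ?]] [[? ? ? ?] [? ? ? ?]].
by congr pair; congr Quat => /=; ring.
Qed.

Fact E_mul_linearr u : linear (E_mul u).
Proof.
move: u => [[? ? ? ?] [? ? ? ?]] a [[? ? ? ?] [? ? ? ?]] [[? ? ? ?] [? ? ? ?]].
by congr pair; congr Quat => /=; ring.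
Qed.

HB.instance Definition _ :=
  isNonAssocAlgebra.Build R E E_mul_linearl E_mul_linearr.

Definition E_of_quat (x : quat R) : E := (x, 0).
Definition E_f : E := (0, 1).

End EAlgebra.

Arguments E_of_quat {R alpha delta} x.
Arguments E_f {R alpha delta}.

(* Main.v *)
Require Import Defs.
From HB Require Import structures.
From mathcomp Require Import all_boot all_order all_algebra.
From mathcomp Require Import boolp reals.
From mathcomp Require Import complex.
From mathcomp Require Import ring lra zify.

Set Implicit Arguments.
Unset Strict Implicit.
Unset Printing Implicit Defensive.

Import Order.TTheory GRing.Theory Num.Theory.

Local Open Scope ring_scope.

(* A derivation D kills 1 and is skew for the norm form of A.  Writing         *)
(* D(x, 0) = (p x, q x - <a, x>) and D f = (a, b) on imaginary quaternions,    *)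
(* the value of D on (x, 0)(0, x') gives delta * q = 0, skewness of D then     *)
(* gives (2 alpha - 1) a = 0, and the value of D on (0, x)(0, x') gives        *)
(* delta * b = 0.  Hence D acts on both copies of H as one inner derivation    *)
(* ad q, with q imaginary, that is, q in su(2).                                *)
(* If u v = 0 with u, v nonzero, associativity of the norm form makes u and v  *)
(* orthogonal vectors of trace 0 whose cross product vanishes; the Plücker     *)
(* relations of the pair (u, v) turn this into the vanishing of positive       *)
(* definite quadratic forms in its 2x2 minors, so that u and v are dependent.  *)

(** * The algebra E is noncommutative Jordan *)

(** The algebra [E] is quadratic: each square lies in the span of the element and the unit
    ([E_sqr]). So flexibility, a polynomial identity in the coordinates, already gives the Jordan
    identity.

    In the other direction of the computation of derivations, the product of [E] is built from the
    product, the conjugation and the real scalars of the quaternions, and commutators with a fixed q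
    respect all of these. Thus [E_ad q] is a derivation, and [E_derivationP] says that there are no
    others. The same holds for the quaternions ([quat_derivationP]). Both Lie algebras are therefore
    the imaginary quaternions with the commutator, which is su(2) ([su2_Der_isomorphism]).

    As a module, [E] is two copies of the quaternions under commutators. Each copy splits into the
    real line, which is killed, and the imaginary part, which is irreducible
    ([irreducible_imaginary]). A dimension count makes the sum direct.

    In finite dimension, division amounts to the absence of zero divisors
    ([linear_division_algebraP]). This follows from [E_mul_eq0], whose core is [E_cross_eq0]: the
    bound on alpha and delta says that a binary quadratic form has negative discriminant. The
    8-dimensional example is alpha = delta = 1. *)

Lemma E_associatorN (R : fieldType) (alpha delta : R)
    (x y : E_algebra alpha delta) : associator x y x = 0.
Proof.
rewrite /associator; case: x => -[x0 x1 x2 x3] [x4 x5 x6 x7].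
case: y => -[y0 y1 y2 y3] [y4 y5 y6 y7].
rewrite /amul /=; generalize (delta / 2%:R) => d.
by congr pair; congr Quat => /=; ring.
Qed.

Lemma E_sqr (R : fieldType) (alpha delta : R) (x : E_algebra alpha delta) :
  exists t n : R, x ** x = t *: x + n *: (1, 0).
Proof.
case: x => -[x0 x1 x2 x3] [x4 x5 x6 x7].
exists (2 * x0), (- (x0 ^+ 2 + x1 ^+ 2 + x2 ^+ 2 + x3 ^+ 2
  + x4 ^+ 2 + x5 ^+ 2 + x6 ^+ 2 + x7 ^+ 2)).
rewrite /amul /=; generalize (delta / 2%:R) => d.
by congr pair; congr Quat => /=; ring.
Qed.

Lemma E_1mul (R : fieldType) (alpha delta : R) (x : E_algebra alpha delta) :
  ((1, 0) : E_algebra alpha delta) ** x = x.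
Proof.
case: x => -[x0 x1 x2 x3] [x4 x5 x6 x7].
by congr pair; congr Quat => /=; ring.
Qed.

(** By [E_sqr], (x^2, y, x) is a combination of (x, y, x) and (1, y, x); flexibility kills the first
    and the unit law the second. *)
Lemma E_noncommutative_jordan (R : fieldType) (alpha delta : R) :
  noncommutative_jordan (E_algebra alpha delta).
Proof.
move=> x y; split; first exact: E_associatorN.
have [t [n ->]] := E_sqr x.
rewrite /associator amulDl !amulZl E_1mul !amulDl !amulZl E_1mul opprD.
by rewrite addrACA subrr addr0 -scalerBr -/(associator x y x) E_associatorN
  scaler0.
Qed.

(** * Absence of zero divisors *)

(* The conclusion is |u|^2 |v|^2 = 0 for u = (x, s, a) and v = (x', s', a'),  *)
(* which equals the sum of the squares of the 2x2 minors P, Q, L, M, N of the *)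
(* matrix with rows u and v.  MP, LQ, MW and N2 are Plücker relations.        *)
Lemma E_cross_eq0 (R : realFieldType) (c d x1 x2 x3 s a1 a2 a3
    x1' x2' x3' s' a1' a2' a3' : R) : 0 < c -> c * d ^+ 2 < 4 ->
  let n := x1 ^+ 2 + x2 ^+ 2 + x3 ^+ 2 + s ^+ 2
    + a1 ^+ 2 + a2 ^+ 2 + a3 ^+ 2 in
  let n' := x1' ^+ 2 + x2' ^+ 2 + x3' ^+ 2 + s' ^+ 2
    + a1' ^+ 2 + a2' ^+ 2 + a3' ^+ 2 in
  x1 * x1' + x2 * x2' + x3 * x3' + s * s'
    + a1 * a1' + a2 * a2' + a3 * a3' = 0 ->
  c * (x2 * x3' - x3 * x2') = (a2 * a3' - a3 * a2') + (s' * a1 - s * a1') ->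
  c * (x3 * x1' - x1 * x3') = (a3 * a1' - a1 * a3') + (s' * a2 - s * a2') ->
  c * (x1 * x2' - x2 * x1') = (a1 * a2' - a2 * a1') + (s' * a3 - s * a3') ->
  a1 * x1' + a2 * x2' + a3 * x3' = a1' * x1 + a2' * x2 + a3' * x3 ->
  (x2 * a3' - x3 * a2') - (x2' * a3 - x3' * a2)
    = (s' * x1 - s * x1') - d * (a2 * a3' - a3 * a2') ->
  (x3 * a1' - x1 * a3') - (x3' * a1 - x1' * a3)
    = (s' * x2 - s * x2') - d * (a3 * a1' - a1 * a3') ->
  (x1 * a2' - x2 * a1') - (x1' * a2 - x2' * a1)
    = (s' * x3 - s * x3') - d * (a1 * a2' - a2 * a1') ->
  n * n' = 0.
Proof.
move=> c0 cd n n' uv eP1 eP2 eP3 tN eW1 eW2 eW3.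
pose N11 := x1 * a1' - x1' * a1; pose N12 := x1 * a2' - x1' * a2.
pose N13 := x1 * a3' - x1' * a3; pose N21 := x2 * a1' - x2' * a1.
pose N22 := x2 * a2' - x2' * a2; pose N23 := x2 * a3' - x2' * a3.
pose N31 := x3 * a1' - x3' * a1; pose N32 := x3 * a2' - x3' * a2.
pose N33 := x3 * a3' - x3' * a3.
pose P1 := x2 * x3' - x3 * x2'; pose P2 := x3 * x1' - x1 * x3'.
pose P3 := x1 * x2' - x2 * x1'.
pose Q1 := a2 * a3' - a3 * a2'; pose Q2 := a3 * a1' - a1 * a3'.
pose Q3 := a1 * a2' - a2 * a1'.
pose L1 := s' * a1 - s * a1'; pose L2 := s' * a2 - s * a2'.
pose L3 := s' * a3 - s * a3'.
pose M1 := s' * x1 - s * x1'; pose M2 := s' * x2 - s * x2'.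
pose M3 := s' * x3 - s * x3'.
have lagrange : n * n' = P1 ^+ 2 + P2 ^+ 2 + P3 ^+ 2
    + (Q1 ^+ 2 + Q2 ^+ 2 + Q3 ^+ 2) + (L1 ^+ 2 + L2 ^+ 2 + L3 ^+ 2)
    + (M1 ^+ 2 + M2 ^+ 2 + M3 ^+ 2) + (N11 ^+ 2 + N12 ^+ 2 + N13 ^+ 2)
    + (N21 ^+ 2 + N22 ^+ 2 + N23 ^+ 2) + (N31 ^+ 2 + N32 ^+ 2 + N33 ^+ 2).
  (* Subtracting 0 * 0, with each 0 read as the inner product of u and v, turns the claim into
     Lagrange's identity. *)
  rewrite -[LHS]subr0 -[in LHS](mulr0 0) -{}uv /n /n' /P1 /P2 /P3 /Q1 /Q2 /Q3.
  rewrite /L1 /L2 /L3 /M1 /M2 /M3 /N11 /N12 /N13 /N21 /N22 /N23.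
  by rewrite /N31 /N32 /N33; ring.
have MP : M1 * P1 + M2 * P2 + M3 * P3 = 0.
  by rewrite /M1 /M2 /M3 /P1 /P2 /P3; ring.
have LQ : L1 * Q1 + L2 * Q2 + L3 * Q3 = 0.
  by rewrite /L1 /L2 /L3 /Q1 /Q2 /Q3; ring.
have MW : M1 * (N23 - N32) + M2 * (N31 - N13) + M3 * (N12 - N21) =
    - (L1 * P1 + L2 * P2 + L3 * P3).
  rewrite /L1 /L2 /L3 /M1 /M2 /M3 /P1 /P2 /P3 /N12 /N13 /N21 /N23.
  by rewrite /N31 /N32; ring.
have N2 : N11 * N22 - N12 * N21 + (N11 * N33 - N13 * N31)
    + (N22 * N33 - N23 * N32) = P1 * Q1 + P2 * Q2 + P3 * Q3.
  rewrite /Q1 /Q2 /Q3 /P1 /P2 /P3 /N11 /N22 /N33 /N12 /N13 /N21 /N23.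
  by rewrite /N31 /N32; ring.
have {}tN : N33 = - N11 - N22 by move: tN; rewrite /N11 /N22 /N33; lra.
have {}eW1 : N23 = N32 + M1 - d * Q1.
  by move: eW1; rewrite /N23 /N32 /M1 /Q1; lra.
have {}eW2 : N31 = N13 + M2 - d * Q2.
  by move: eW2; rewrite /N31 /N13 /M2 /Q2; lra.
have {}eW3 : N12 = N21 + M3 - d * Q3.
  by move: eW3; rewrite /N12 /N21 /M3 /Q3; lra.
have {}eP1 : c * P1 = Q1 + L1 by [].
have {}eP2 : c * P2 = Q2 + L2 by [].
have {}eP3 : c * P3 = Q3 + L3 by [].
rewrite {}lagrange.
move: N11 N12 N13 N21 N22 N23 N31 N32 N33 P1 P2 P3 Q1 Q2 Q3 L1 L2 L3
  M1 M2 M3 MP LQ MW N2 tN eW1 eW2 eW3 eP1 eP2 eP3.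
(* From here on the minors are independent unknowns, tied only by the Plücker relations and the
   equations from u v = 0. *)
clear - c0 cd.
move=> N11 N12 N13 N21 N22 N23 N31 N32 N33 P1 P2 P3 Q1 Q2 Q3 L1 L2 L3
  M1 M2 M3 MP LQ MW N2 tN eW1 eW2 eW3 eP1 eP2 eP3.
have MQ : M1 * Q1 + M2 * Q2 + M3 * Q3 = - (M1 * L1 + M2 * L2 + M3 * L3).
  have -> : Q1 = c * P1 - L1 by rewrite eP1 addrK.
  have -> : Q2 = c * P2 - L2 by rewrite eP2 addrK.
  have -> : Q3 = c * P3 - L3 by rewrite eP3 addrK.
  by apply/eqP; rewrite -subr_eq0; apply/eqP; transitivity
    (c * (M1 * P1 + M2 * P2 + M3 * P3)); [ring | rewrite MP mulr0].
have {}MQ : M1 * Q1 + M2 * Q2 + M3 * Q3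
    = - (M1 * L1 + M2 * L2 + M3 * L3) by [].
(* This is [MW] multiplied by c: its left side is c M.(M - d Q) with M.Q = - M.L, its right side is
   - L.(Q + L) with L.Q = 0. *)
have form0 : (c * M1 ^+ 2 + c * d * M1 * L1 + L1 ^+ 2)
    + (c * M2 ^+ 2 + c * d * M2 * L2 + L2 ^+ 2)
    + (c * M3 ^+ 2 + c * d * M3 * L3 + L3 ^+ 2) = 0.
  transitivity (c * (M1 * (M1 - d * Q1) + M2 * (M2 - d * Q2)
      + M3 * (M3 - d * Q3)) + c * d * (M1 * Q1 + M2 * Q2 + M3 * Q3
      + (M1 * L1 + M2 * L2 + M3 * L3)) + (L1 ^+ 2 + L2 ^+ 2 + L3 ^+ 2)).
    by ring.
  rewrite MQ addNr mulr0 addr0.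
  transitivity (c * (M1 * (N23 - N32) + M2 * (N31 - N13) + M3 * (N12 - N21))
      + (L1 ^+ 2 + L2 ^+ 2 + L3 ^+ 2)); first by rewrite eW1 eW2 eW3; ring.
  rewrite MW; transitivity (- (L1 * (c * P1) + L2 * (c * P2) + L3 * (c * P3))
      + (L1 ^+ 2 + L2 ^+ 2 + L3 ^+ 2)); first by ring.
  rewrite eP1 eP2 eP3; transitivity (- (L1 * Q1 + L2 * Q2 + L3 * Q3)).
    by ring.
  by rewrite LQ oppr0.
(* The form c m^2 + c d m l + l^2 has discriminant c (c d^2 - 4), negative by hypothesis; completing
   the square shows that it is definite. *)
have cd' : 0 < 1 - c * d ^+ 2 / 4 by lra.
have sq_form (m l : R) : c * m ^+ 2 + c * d * m * l + l ^+ 2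
    = (l + c * d * m / 2) ^+ 2 + c * (1 - c * d ^+ 2 / 4) * m ^+ 2 by field.
have form_ge0 (m l : R) : 0 <= c * m ^+ 2 + c * d * m * l + l ^+ 2.
  by rewrite sq_form addr_ge0 ?sqr_ge0// mulr_ge0 ?sqr_ge0// mulr_ge0// ltW.
have form_eq0 (m l : R) :
    c * m ^+ 2 + c * d * m * l + l ^+ 2 = 0 -> m = 0 /\ l = 0.
  rewrite sq_form => /eqP; rewrite paddr_eq0 ?sqr_ge0//; last first.
    by rewrite mulr_ge0 ?sqr_ge0// mulr_ge0// ltW.
  rewrite sqrf_eq0 mulf_eq0 sqrf_eq0 mulf_eq0 !(gt_eqF c0, gt_eqF cd') /=.
  by case/andP=> + /eqP m0; rewrite m0 mulr0 mul0r addr0 => /eqP ->.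
have [[M10 L10] [M20 L20] [M30 L30]] :
    [/\ M1 = 0 /\ L1 = 0, M2 = 0 /\ L2 = 0 & M3 = 0 /\ L3 = 0].
  have := form_ge0 M3 L3; have := form_ge0 M2 L2; have := form_ge0 M1 L1.
  by move=> p1 p2 p3; split; apply: form_eq0; lra.
move: eW1 eW2 eW3 eP1 eP2 eP3; rewrite {}M10 {}L10 {}M20 {}L20 {}M30 {}L30.
rewrite !addr0 => eW1 eW2 eW3 eP1 eP2 eP3.
(* Now c P = Q, so c times [N2] has right side |Q|^2. Trace 0 turns the diagonal products into minus
   half the sum of the squares, and N12 = N21 - d Q3 and its analogues let the off-diagonal products
   be completed to squares. *)
have sos0 : c * (N11 ^+ 2 / 2) + c * (N22 ^+ 2 / 2) + c * (N33 ^+ 2 / 2)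
    + c * (N32 - d * Q1 / 2) ^+ 2 + c * (N13 - d * Q2 / 2) ^+ 2
    + c * (N21 - d * Q3 / 2) ^+ 2 + (1 - c * d ^+ 2 / 4) * Q1 ^+ 2
    + (1 - c * d ^+ 2 / 4) * Q2 ^+ 2 + (1 - c * d ^+ 2 / 4) * Q3 ^+ 2 = 0.
  transitivity (c * (P1 * Q1 + P2 * Q2 + P3 * Q3)
    - c * (N11 * N22 - N12 * N21 + (N11 * N33 - N13 * N31)
    + (N22 * N33 - N23 * N32))); last by rewrite N2 subrr.
  transitivity ((c * P1) * Q1 + (c * P2) * Q2 + (c * P3) * Q3
    - c * (N11 * N22 - N12 * N21 + (N11 * N33 - N13 * N31)
    + (N22 * N33 - N23 * N32))); last by ring.
  by rewrite eP1 eP2 eP3 tN eW1 eW2 eW3; field.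
have sq1 (z : R) : 0 <= c * z ^+ 2 by rewrite mulr_ge0 ?sqr_ge0// ltW.
have sq2 (z : R) : 0 <= c * (z ^+ 2 / 2).
  by rewrite mulr_ge0 ?divr_ge0 ?sqr_ge0// ltW.
have sq3 (z : R) : 0 <= (1 - c * d ^+ 2 / 4) * z ^+ 2.
  by rewrite mulr_ge0 ?sqr_ge0// ltW.
have sq1E (z : R) : (c * z ^+ 2 == 0) = (z == 0).
  by rewrite mulf_eq0 sqrf_eq0 gt_eqF.
have sq2E (z : R) : (c * (z ^+ 2 / 2) == 0) = (z == 0).
  by rewrite mulf_eq0 (gt_eqF c0) mulf_eq0 sqrf_eq0 invr_eq0 pnatr_eq0 orbF.
have sq3E (z : R) : ((1 - c * d ^+ 2 / 4) * z ^+ 2 == 0) = (z == 0).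
  by rewrite mulf_eq0 sqrf_eq0 gt_eqF.
move/eqP: sos0; rewrite !paddr_eq0 ?addr_ge0// !(sq2E, sq1E, sq3E).
case/andP=> /andP[/andP[/andP[/andP[/andP[/andP[/andP[]]]]]]].
move=> /eqP N110 /eqP N220 /eqP N330 /eqP N320 /eqP N130 /eqP N210.
move=> /eqP Q10 /eqP Q20 /eqP Q30.
move: N320 N130 N210 eW1 eW2 eW3 eP1 eP2 eP3.
rewrite N110 N220 N330 {}Q10 {}Q20 {}Q30 !(mulr0, mul0r, subr0).
move=> -> -> -> -> -> -> /eqP + /eqP + /eqP; rewrite !mulf_eq0 gt_eqF//=.
move=> /eqP -> /eqP -> /eqP ->.
by rewrite expr0n /= !addr0.
Qed.

Lemma sum8_sqr_eq0 (R : realFieldType) (z0 z1 z2 z3 z4 z5 z6 z7 : R) :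
  z0 ^+ 2 + (z1 ^+ 2 + z2 ^+ 2 + z3 ^+ 2 + z4 ^+ 2 + z5 ^+ 2 + z6 ^+ 2
    + z7 ^+ 2) = 0 -> (Quat z0 z1 z2 z3, Quat z4 z5 z6 z7) = 0.
Proof.
move/eqP; rewrite !paddr_eq0 ?(sqr_ge0, addr_ge0)// !sqrf_eq0.
case/andP=> /eqP -> /andP[/andP[/andP[/andP[/andP[/andP[]]]]]].
by do 7!move=> /eqP ->.
Qed.

Lemma E_mul_eq0 (R : realFieldType) (alpha delta : R)
    (u v : E_algebra alpha delta) :
  1 / 2 < alpha -> (2 * alpha - 1) * delta ^+ 2 < 4 -> u ** v = 0 ->
  u = 0 \/ v = 0.
Proof.
move=> ha hd; case: u => -[t x1 x2 x3] [s a1 a2 a3].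
case: v => -[t' x1' x2' x3'] [s' a1' a2' a3'].
rewrite /amul /= => -[].
move=> e0 e1 e2 e3 e4 e5 e6 e7.
pose n := x1 ^+ 2 + x2 ^+ 2 + x3 ^+ 2 + s ^+ 2
    + a1 ^+ 2 + a2 ^+ 2 + a3 ^+ 2.
pose n' := x1' ^+ 2 + x2' ^+ 2 + x3' ^+ 2 + s' ^+ 2
    + a1' ^+ 2 + a2' ^+ 2 + a3' ^+ 2.
have /eqP : t' * (t ^+ 2 + n) = 0.
  (* The inner product of u v with u is t' |u|^2; it is computed here with the coordinates of u v =
     0 in place of the zeros. *)
  transitivity (t * 0 + x1 * 0 + x2 * 0 + x3 * 0 + s * 0 + a1 * 0 + a2 * 0
    + a3 * 0); last by rewrite !mulr0 !addr0.
  rewrite -{1}e0 -{1}e1 -{1}e2 -{1}e3 -{1}e4 -{1}e5 -{1}e6 -{1}e7 /n.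
  by field.
rewrite mulf_eq0 => /orP[/eqP t'0|/eqP/sum8_sqr_eq0]; last by left.
have /eqP : t * (t' ^+ 2 + n') = 0.
  transitivity (t' * 0 + x1' * 0 + x2' * 0 + x3' * 0 + s' * 0 + a1' * 0
    + a2' * 0 + a3' * 0); last by rewrite !mulr0 !addr0.
  rewrite -{1}e0 -{1}e1 -{1}e2 -{1}e3 -{1}e4 -{1}e5 -{1}e6 -{1}e7 /n'.
  by field.
rewrite mulf_eq0 => /orP[/eqP t0|/eqP/sum8_sqr_eq0]; last by right.
move: e0 e1 e2 e3 e4 e5 e6 e7; rewrite t0 t'0 => e0 e1 e2 e3 e4 e5 e6 e7.
have /eqP : n * n' = 0.
  (* On imaginary x, x', the product alpha x x' + (1 - alpha) x' x has imaginary part 2 alpha - 1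
     times the cross product, whence c. *)
  by apply: (E_cross_eq0 (c := 2 * alpha - 1) (d := delta)); lra.
rewrite mulf_eq0 => /orP[]/eqP nz; [left|right]; apply: sum8_sqr_eq0.
  by rewrite expr0n add0r.
by rewrite expr0n add0r.
Qed.

Lemma lfun_bijective (R : fieldType) (V : vectType R) (f : 'End(V)) :
  (forall x, f x = 0 -> x = 0) -> bijective f.
Proof.
move=> f0; have kf : lker f == 0%VS.
  by rewrite -subv0; apply/subvP => x; rewrite memv_ker memv0 => /eqP/f0/eqP.
exact: Bijective (lker0_lfunK kf) (lker0_lfunVK kf).
Qed.

(** Multiplication by a nonzero x on either side is then an injective endomorphism of a
    finite-dimensional space, hence bijective. *)
Lemma linear_division_algebraP (R : fieldType) (A : naAlgType R) :
  (exists x : A, x != 0) -> (forall x y : A, x ** y = 0 -> x = 0 \/ y = 0) ->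
  linear_division_algebra A.
Proof.
move=> A0 dom; split=> // x x0.
pose ml : {linear A -> A} :=
  HB.pack (amul x) (GRing.isLinear.Build R A A *:%R _ (amul_linearr x)).
pose mr : {linear A -> A} := HB.pack (fun y => y ** x)
  (GRing.isLinear.Build R A A *:%R _ (amul_linearl x)).
split.
- apply: (eq_bij (f := linfun ml)) => [|y]; last by rewrite lfunE.
  apply: lfun_bijective => y; rewrite lfunE => /dom[] // xE.
  by rewrite xE eqxx in x0.
- apply: (eq_bij (f := linfun mr)) => [|y]; last by rewrite lfunE.
  apply: lfun_bijective => y; rewrite lfunE => /dom[] // xE.
  by rewrite xE eqxx in x0.
Qed.

Lemma E_linear_division (R : realFieldType) (alpha delta : R) :
  1 / 2 < alpha -> (2 * alpha - 1) * delta ^+ 2 < 4 ->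
  linear_division_algebra (E_algebra alpha delta).
Proof.
move=> ha hd; apply: linear_division_algebraP => [|x y].
  by exists (1, 0); apply/eqP => -[] /eqP; rewrite oner_eq0.
exact: E_mul_eq0.
Qed.

(** * su(2) and imaginary quaternions *)

Lemma inj_surj_bijective (T U : Type) (f : T -> U) :
  injective f -> (forall y, exists x, f x = y) -> bijective f.
Proof.
move=> finj fsurj; pose g y := projT1 (cid (fsurj y)).
have gK : cancel g f by move=> y; rewrite /g; case: cid.
by exists g => // x; apply: finj; rewrite gK.
Qed.

Lemma lie_isomorphic_sym (R : fieldType) (L L' : lieAlgType R) :
  lie_isomorphic L L' -> lie_isomorphic L' L.
Proof.
case=> phi [[psi phiK psiK] phi_lie].
pose f : {linear L' -> L} := HB.pack psi
  (GRing.isLinear.Build R L' L *:%R psi (can2_linear phiK psiK)).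
exists f; split=> [|x y]; first by exists phi.
by apply: (can_inj phiK); rewrite phi_lie /= !psiK.
Qed.

Lemma lie_isomorphic_trans (R : fieldType) (L L' L'' : lieAlgType R) :
  lie_isomorphic L L' -> lie_isomorphic L' L'' -> lie_isomorphic L L''.
Proof.
case=> phi [phi_bij phi_lie] [psi [psi_bij psi_lie]].
exists (psi \o phi); split=> [|x y]; first exact: bij_comp.
by rewrite /= phi_lie psi_lie.
Qed.

Section su2_quat.
Variable R : rcfType.

(** The matrix with rows (b i, c + d i) and (- c + d i, - b i) goes to b i + c j + d k; the first
    row determines it. This respects commutators without any factor. *)
Definition quat_of_su2 (X : su R 2) : quat R :=
  Quat 0 (complex.Im (su_mx X 0 0)) (complex.Re (su_mx X 0 1))
         (complex.Im (su_mx X 0 1)).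

Lemma su2P (X : su R 2) : exists b c d : R,
  [/\ su_mx X 0 0 = Complex 0 b, su_mx X 0 1 = Complex c d,
      su_mx X 1 0 = Complex (- c) d & su_mx X 1 1 = Complex 0 (- b)].
Proof.
case: X => X /= /skew_hermitian0P[hX]; rewrite /mxtrace !big_ord_recl big_ord0.
have -> : lift ord0 ord0 = 1 :> 'I_2 by apply: val_inj.
have := congr1 (fun Y : 'M_2 => Y 1 1) hX.
have := congr1 (fun Y : 'M_2 => Y 0 1) hX.
have := congr1 (fun Y : 'M_2 => Y 0 0) hX.
rewrite /adjmx !mxE.
case: (X 0 0) (X 0 1) (X 1 0) (X 1 1) => [a b] [c d] [e f] [g h].
move=> /(congr1 (@complex.Re R)) /= a0 [ec df].
move=> /(congr1 (@complex.Re R)) /= g0 /(congr1 (@complex.Im R)) /= bh.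
exists b, c, d; split; congr Complex; lra.
Qed.

Fact quat_of_su2_is_linear : linear quat_of_su2.
Proof.
move=> a X Y; rewrite /quat_of_su2 /= !mxE.
move: (su_mx X 0 0) (su_mx X 0 1) (su_mx Y 0 0) (su_mx Y 0 1).
by move=> [? ?] [? ?] [? ?] [? ?]; congr Quat => /=; ring.
Qed.

HB.instance Definition _ := GRing.isLinear.Build R (su R 2) (quat R) *:%R
  quat_of_su2 quat_of_su2_is_linear.

Lemma quat_of_su2_inj : injective quat_of_su2.
Proof.
move=> X Y; have [b [c [d [X1 X2 X3 X4]]]] := su2P X.
have [b' [c' [d' [Y1 Y2 Y3 Y4]]]] := su2P Y.
rewrite /quat_of_su2 X1 X2 Y1 Y2 /= => -[eb ec ed].
apply/val_inj/matrixP => i j /=; subst b' c' d'.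
case: i j => [[|[|//]] lti] [[|[|//]] ltj].
- have -> : Ordinal lti = 0 by apply: val_inj.
  have -> : Ordinal ltj = 0 by apply: val_inj.
  by rewrite X1.
- have -> : Ordinal lti = 0 by apply: val_inj.
  have -> : Ordinal ltj = 1 by apply: val_inj.
  by rewrite X2.
- have -> : Ordinal lti = 1 by apply: val_inj.
  have -> : Ordinal ltj = 0 by apply: val_inj.
  by rewrite X3.
- have -> : Ordinal lti = 1 by apply: val_inj.
  have -> : Ordinal ltj = 1 by apply: val_inj.
  by rewrite X4.
Qed.

Definition su2_mx_of_quat (q : quat R) : 'M[R[i]]_2 := \matrix_(i, j)
  if i == 0 then if j == 0 then Complex 0 (quat_im_i q)
                 else Complex (quat_im_j q) (quat_im_k q)
  else if j == 0 then Complex (- quat_im_j q) (quat_im_k q)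
       else Complex 0 (- quat_im_i q).

Fact su2_mx_of_quat_proof q : su2_mx_of_quat q \in @skew_hermitian0 R 2.
Proof.
case: q => a b c d; apply/skew_hermitian0P; split; last first.
  by rewrite /mxtrace !big_ord_recl big_ord0 !mxE /=; congr Complex;
    rewrite /= ?addr0 ?subrr.
apply/matrixP => i j; rewrite /adjmx !mxE.
by case: i j => [[|[|//]] lti] [[|[|//]] ltj] /=; congr Complex;
  rewrite ?oppr0 ?opprK.
Qed.

Lemma quat_of_su2_surj q : quat_re q = 0 -> exists X, quat_of_su2 X = q.
Proof.
case: q => a b c d /= ->.
exists (MkSu (su2_mx_of_quat_proof (Quat 0 b c d))).
by rewrite /quat_of_su2 /= !mxE.
Qed.

Lemma quat_of_su2_bracket (X Y : su R 2) : quat_of_su2 (lie X Y) =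
  quat_of_su2 X * quat_of_su2 Y - quat_of_su2 Y * quat_of_su2 X.
Proof.
have [b [c [d [X1 X2 X3 X4]]]] := su2P X.
have [b' [c' [d' [Y1 Y2 Y3 Y4]]]] := su2P Y.
rewrite /quat_of_su2 X1 X2 Y1 Y2 /= !mxE !big_ord_recl !big_ord0 /=.
have -> : lift ord0 ord0 = 1 :> 'I_2 by apply: val_inj.
rewrite X1 X2 X3 X4 Y1 Y2 Y3 Y4.
by congr Quat => /=; ring.
Qed.

(* Only the restriction of [ad] to imaginary quaternions, i.e. su(2), counts. *)
Lemma su2_Der_isomorphism (A : naAlgType R) (ad : quat R -> 'End(A)) :
  linear ad -> (forall q, ad q \in @derivation R A) ->
  (forall p q, ad (p * q - q * p) = ((ad p \o ad q) - (ad q \o ad p))%VF) ->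
  (forall q, quat_re q = 0 -> ad q = 0 -> q = 0) ->
  (forall d, d \in @derivation R A -> exists2 q, quat_re q = 0 & d = ad q) ->
  exists2 phi : {linear su R 2 -> Der A}, lie_isomorphism phi &
    forall X, der_fun (phi X) = ad (quat_of_su2 X).
Proof.
move=> ad_lin ad_der ad_br ad_inj ad_surj.
pose f (X : su R 2) : Der A := MkDer (ad_der (quat_of_su2 X)).
have f_lin : linear f.
  by move=> a X Y; apply: val_inj; rewrite /= linearP ad_lin.
pose phi : {linear su R 2 -> Der A} := HB.pack f
  (GRing.isLinear.Build R (su R 2) (Der A) *:%R f f_lin).
exists phi => //; split=> [|X Y]; last first.
  by apply: val_inj; rewrite /= quat_of_su2_bracket ad_br.
apply: inj_surj_bijective => [|[d dD]].
  apply: raddf_inj => X /(congr1 (@der_fun _ _)) /= X0.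
  by apply: quat_of_su2_inj; rewrite linear0; apply: ad_inj.
have [q q0 dE] := ad_surj d dD; have [X XE] := quat_of_su2_surj q0.
by exists X; apply: val_inj; rewrite /= dE XE.
Qed.

End su2_quat.

(** * Derivations *)

Section quat_derivations.
Variable R : realFieldType.
Implicit Types (p q x : quat R) (a : R).

Definition quat_comm q x := q * x - x * q.

Fact quat_comm_is_linear q : linear (quat_comm q).
Proof.
move=> a x y; rewrite /quat_comm mulrDl mulrDr -scalerAl -scalerAr scalerBr opprD.
by rewrite addrACA.
Qed.

HB.instance Definition _ q := GRing.isLinear.Build R (quat R) (quat R) *:%R
  (quat_comm q) (quat_comm_is_linear q).

Definition quat_ad q : 'End(quat R) := linfun (quat_comm q).

Lemma quat_adE q x : quat_ad q x = q * x - x * q.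
Proof. by rewrite lfunE. Qed.

Fact quat_ad_linear : linear quat_ad.
Proof.
move=> a p q; apply/lfunP => x; rewrite !(add_lfunE, scale_lfunE) !quat_adE.
by rewrite mulrDl mulrDr -scalerAl -scalerAr scalerBr opprD addrACA.
Qed.

Lemma quat_ad_derivation q : quat_ad q \in @derivation R (quat R).
Proof.
apply/asboolP => x y; rewrite !quat_adE /amul /= mulrBl mulrBr !mulrA.
by rewrite addrA subrK.
Qed.

Lemma quat_ad_bracket p q : quat_ad (p * q - q * p) =
  ((quat_ad p \o quat_ad q) - (quat_ad q \o quat_ad p))%VF.
Proof.
apply/lfunP => x; rewrite !(add_lfunE, opp_lfunE, comp_lfunE) !quat_adE.
case: p q x => [p0 p1 p2 p3] [q0 q1 q2 q3] [x0 x1 x2 x3].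
by congr Quat => /=; ring.
Qed.

Lemma quat_ad_inj q : quat_re q = 0 -> quat_ad q = 0 -> q = 0.
Proof.
case: q => q0 q1 q2 q3 /= -> q_0.
have := congr1 (fun d : 'End(_) => d quat_j) q_0.
have := congr1 (fun d : 'End(_) => d quat_i) q_0.
rewrite !zero_lfunE !quat_adE => -[_ _ j2 j3] [_ i1 _ i3].
by congr Quat; lra.
Qed.

Lemma quat_basis x : x = quat_re x *: 1 + quat_im_i x *: quat_i
  + quat_im_j x *: quat_j + quat_im_k x *: quat_k.
Proof. by case: x => x0 x1 x2 x3; rewrite -[1]/(Quat 1 0 0 0); congr Quat => /=; ring. Qed.

(** The relations i^2 = j^2 = k^2 = -1 and i j = k make d a skew map of the imaginary quaternions,
    and in dimension 3 these are the commutators. *)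
Lemma quat_derivationP (d : 'End(quat R)) : d \in @derivation R (quat R) ->
  exists2 q, quat_re q = 0 & d = quat_ad q.
Proof.
move=> /asboolP dD.
have d1 : d 1 = 0.
  have := dD 1 1; rewrite /amul /= !mulr1 mul1r.
  by move/(congr1 (fun z => z - d 1)); rewrite addrK subrr.
have dE x : d x = quat_im_i x *: d quat_i + quat_im_j x *: d quat_j
    + quat_im_k x *: d quat_k.
  by rewrite [in LHS](quat_basis x) !linearD !linearZ /= d1 scaler0 add0r.
case di : (d quat_i) => [i0 i1 i2 i3].
case dj : (d quat_j) => [j0 j1 j2 j3].
case dk : (d quat_k) => [k0 k1 k2 k3].
rewrite {}di {}dj {}dk in dE.
have := dD quat_i quat_i; have := dD quat_j quat_j; have := dD quat_k quat_k.
have := dD quat_i quat_j.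
rewrite !dE /amul /=.
move=> -[ij0 ij1 ij2 ij3] [kk0 kk1 kk2 kk3] [jj0 jj1 jj2 jj3].
move=> [ii0 ii1 ii2 ii3].
have [i00 i10 j00 j20] : [/\ i0 = 0, i1 = 0, j0 = 0 & j2 = 0].
  by clear -ii0 ii1 jj0 jj2; split; lra.
have [k00 k30] : k0 = 0 /\ k3 = 0 by clear -kk0 kk3; split; lra.
have [j1E k1E k2E] : [/\ j1 = - i2, k1 = - i3 & k2 = - j3].
  by clear -ij0 ij1 ij2 k00 i00 j00; split; lra.
subst i0 i1 j0 j2 k0 k3 j1 k1 k2.
(* Read off from [q, i] = 2 (q3 j - q2 k) and [q, j] = 2 (q1 k - q3 i). *)
exists (Quat 0 (j3 / 2) (- i3 / 2) (i2 / 2)) => //; apply/lfunP => x.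
rewrite quat_adE dE; case: x => x0 x1 x2 x3.
by congr Quat => /=; field.
Qed.

End quat_derivations.

(** * Derivations of [E] *)

Local Ltac E_ring := by congr pair; congr Quat => /=; field.

Section E_derivations.
Variables (R : realFieldType) (alpha delta : R).
Implicit Types (p q x : quat R) (a : R).
Local Notation E := (E_algebra alpha delta).

Definition E_comm q (u : E) : E := (quat_comm q u.1, quat_comm q u.2).

Fact E_comm_is_linear q : linear (E_comm q).
Proof. by move=> a u v; congr pair; rewrite /= linearP. Qed.

HB.instance Definition _ q := GRing.isLinear.Build R E E *:%R
  (E_comm q) (E_comm_is_linear q).

Definition E_ad q : 'End(E) := linfun (E_comm q).

Lemma E_adE q u : E_ad q u = (quat_ad q u.1, quat_ad q u.2).
Proof. by rewrite lfunE /= !quat_adE. Qed.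

Fact E_ad_linear : linear E_ad.
Proof.
move=> a p q; apply/lfunP => x; rewrite !(add_lfunE, scale_lfunE) !E_adE.
by congr pair; rewrite quat_ad_linear !(add_lfunE, scale_lfunE).
Qed.

Lemma E_ad_derivation q : E_ad q \in @derivation R E.
Proof.
apply/asboolP => x y; rewrite !E_adE !quat_adE.
case: q x y => [q0 q1 q2 q3] [[x0 x1 x2 x3] [x4 x5 x6 x7]].
case=> -[y0 y1 y2 y3] [y4 y5 y6 y7]; rewrite /amul /=.
generalize (delta / 2%:R) => d.
by congr pair; congr Quat => /=; ring.
Qed.

Lemma E_ad_bracket p q :
  E_ad (p * q - q * p) = ((E_ad p \o E_ad q) - (E_ad q \o E_ad p))%VF.
Proof.
apply/lfunP => x; rewrite !(add_lfunE, opp_lfunE, comp_lfunE) !E_adE /=.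
by congr pair; rewrite quat_ad_bracket !(add_lfunE, opp_lfunE, comp_lfunE).
Qed.

Lemma E_ad_inj q : quat_re q = 0 -> E_ad q = 0 -> q = 0.
Proof.
move=> q0 q_0; apply: quat_ad_inj => //; apply/lfunP => x.
have := congr1 (fun d : 'End(_) => d (x, 0)) q_0.
by rewrite !zero_lfunE E_adE /= => -[].
Qed.

Lemma E_derivationP (d : 'End(E)) : delta != 0 -> alpha != 1 / 2 ->
  d \in @derivation R E -> exists2 q, quat_re q = 0 & d = E_ad q.
Proof.
move=> delta0 alpha12 /asboolP dD.
have cancel_delta z : delta * z = 0 -> z = 0.
  by move/eqP; rewrite mulf_eq0 (negPf delta0) => /eqP.
have cancel_c z : (2 * alpha - 1) * z = 0 -> z = 0.
  move/eqP; rewrite mulf_eq0 => /orP[/eqP c0|/eqP//].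
  by case/eqP: alpha12; move: c0; lra.
pose ei : E := (quat_i, 0); pose ej : E := (quat_j, 0).
pose ek : E := (quat_k, 0); pose f : E := (0, 1).
pose fi : E := (0, quat_i); pose fj : E := (0, quat_j).
pose fk : E := (0, quat_k).
have d1 : d (1, 0) = 0.
  have := dD (1, 0) (1, 0); rewrite !E_1mul.
  case: (d _) => -[x0 x1 x2 x3] [x4 x5 x6 x7].
  by case=> *; congr pair; congr Quat; lra.
have dE u : d u = quat_im_i u.1 *: d ei + quat_im_j u.1 *: d ej
    + quat_im_k u.1 *: d ek + quat_re u.2 *: d f + quat_im_i u.2 *: d fi
    + quat_im_j u.2 *: d fj + quat_im_k u.2 *: d fk.
  rewrite -[RHS]add0r -(scaler0 _ (quat_re u.1)) -d1 !addrA -!linearZ -!linearD.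
  congr (d _); case: u => -[u0 u1 u2 u3] [u4 u5 u6 u7].
  by congr pair; congr Quat => /=; ring.
have mulE (x y z : E) : x ** y = z -> d x ** y + x ** d y = d z.
  by move=> <-; rewrite dD.
have sqrE (x : E) : x ** x = - (1, 0) -> d x ** x + x ** d x = 0.
  by move/mulE ->; rewrite linearN /= d1 oppr0.
have mulNE (x y z : E) : x ** y = - z -> d x ** y + x ** d y = - d z.
  by move/mulE ->; rewrite linearN.
have dfi : d ei ** f + ei ** d f = d fi by apply: mulE; E_ring.
have dfj : d ej ** f + ej ** d f = d fj by apply: mulE; E_ring.
have dfk : d ek ** f + ek ** d f = d fk by apply: mulE; E_ring.
have ii : d ei ** ei + ei ** d ei = 0 by apply: sqrE; E_ring.
have jj : d ej ** ej + ej ** d ej = 0 by apply: sqrE; E_ring.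
have kk : d ek ** ek + ek ** d ek = 0 by apply: sqrE; E_ring.
have ff : d f ** f + f ** d f = 0 by apply: sqrE; E_ring.
have fii : d fi ** fi + fi ** d fi = 0 by apply: sqrE; E_ring.
have fjj : d fj ** fj + fj ** d fj = 0 by apply: sqrE; E_ring.
have fkk : d fk ** fk + fk ** d fk = 0 by apply: sqrE; E_ring.
have ij : d ei ** ej + ei ** d ej = d ((2 * alpha - 1) *: ek).
  by apply: mulE; E_ring.
have jk : d ej ** ek + ej ** d ek = d ((2 * alpha - 1) *: ei).
  by apply: mulE; E_ring.
have ki : d ek ** ei + ek ** d ei = d ((2 * alpha - 1) *: ej).
  by apply: mulE; E_ring.
rewrite linearZ /= in ij; rewrite linearZ /= in jk; rewrite linearZ /= in ki.
have ifi : d ei ** fi + ei ** d fi = - d f by apply: mulNE; E_ring.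
have jfj : d ej ** fj + ej ** d fj = - d f by apply: mulNE; E_ring.
have kfk : d ek ** fk + ek ** d fk = - d f by apply: mulNE; E_ring.
have ifj : d ei ** fj + ei ** d fj = - d fk by apply: mulNE; E_ring.
have jfk : d ej ** fk + ej ** d fk = - d fi by apply: mulNE; E_ring.
have kfi : d ek ** fi + ek ** d fi = - d fj by apply: mulNE; E_ring.
have fij : d fi ** fj + fi ** d fj = - d (ek + delta *: fk).
  by apply: mulNE; E_ring.
have fjk : d fj ** fk + fj ** d fk = - d (ei + delta *: fi).
  by apply: mulNE; E_ring.
have fki : d fk ** fi + fk ** d fi = - d (ej + delta *: fj).
  by apply: mulNE; E_ring.
rewrite linearD linearZ /= in fij; rewrite linearD linearZ /= in fjk.
rewrite linearD linearZ /= in fki.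
move: (d ei) (d ej) (d ek) (d f) (d fi) (d fj) (d fk) dE dfi dfj dfk ii jj kk
  ff fii fjj fkk ij jk ki ifi jfj kfk ifj jfk kfi fij fjk fki.
clear dD d1 mulE sqrE mulNE.
case=> [[i0 i1 i2 i3] [i4 i5 i6 i7]] [[j0 j1 j2 j3] [j4 j5 j6 j7]].
case=> [[k0 k1 k2 k3] [k4 k5 k6 k7]] [[f0 f1 f2 f3] [f4 f5 f6 f7]].
move=> dfi_ dfj_ dfk_ dE dfi dfj dfk.
(* The images of i f, j f, k f are expressed through those of i, j, k, f, so only four images remain
   unknown. *)
subst dfi_ dfj_ dfk_.
case=> e0 e1 _ _ _ _ _ _.
(* From e^2 = -1, the image of e is orthogonal to 1 and to e; the same is used for j, k and f. *)
have [i00 i10] : i0 = 0 /\ i1 = 0 by clear -e0 e1; split; lra.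
case=> {e1} e0 _ e2 _ _ _ _ _.
have [j00 j20] : j0 = 0 /\ j2 = 0 by clear -e0 e2; split; lra.
case=> {e2} e0 _ _ e3 _ _ _ _.
have [k00 k30] : k0 = 0 /\ k3 = 0 by clear -e0 e3; split; lra.
case=> {e3} e0 _ _ _ e4 _ _ _.
have [f00 f40] : f0 = 0 /\ f4 = 0 by clear -e0 e4; split; lra.
subst i0 i1 j0 j2 k0 k3 f0 f4.
move=> {e0 e4} -[_ _ _ _ _ e5 _ _] [_ _ _ _ _ _ e6 _] [_ _ _ _ _ _ _ e7].
(* The images of i f, j f, k f have trace 0, which is skewness between f and i, j, k. *)
have [f1E f2E f3E] : [/\ f1 = - i4, f2 = - j4 & f3 = - k4].
  by clear -e5 e6 e7; split; lra.
clear e5 e6 e7.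
case=> ij0 _ _ _ _ _ _ _ [jk0 _ _ _ _ _ _ _] [ki0 _ _ _ _ _ _ _].
have [j1E k1E k2E] : [/\ j1 = - i2, k1 = - i3 & k2 = - j3].
  by clear -ij0 ki0 jk0; split; lra.
subst j1 k1 k2 f1 f2 f3; clear ij0 ki0 jk0.
move: dE; set c := 2 * alpha - 1; rewrite -/c in cancel_c.
have -> : ((Quat 0 0 i2 i3, Quat i4 i5 i6 i7) : E) ** f
      + ei ** ((Quat 0 (- i4) (- j4) (- k4), Quat 0 f5 f6 f7) : E)
    = (Quat 0 (- i5) (c * k4 - i6) (- c * j4 - i7),
       Quat (- f5) 0 (i2 + f7) (i3 - f6)) :> E.
  by rewrite /c; E_ring.
have -> : ((Quat 0 (- i2) 0 j3, Quat j4 j5 j6 j7) : E) ** f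
      + ej ** ((Quat 0 (- i4) (- j4) (- k4), Quat 0 f5 f6 f7) : E)
    = (Quat 0 (- c * k4 - j5) (- j6) (c * i4 - j7),
       Quat (- f6) (- i2 - f7) 0 (j3 + f5)) :> E.
  by rewrite /c; E_ring.
have -> : ((Quat 0 (- i3) (- j3) 0, Quat k4 k5 k6 k7) : E) ** f
      + ek ** ((Quat 0 (- i4) (- j4) (- k4), Quat 0 f5 f6 f7) : E)
    = (Quat 0 (c * j4 - k5) (- c * i4 - k6) (- k7),
       Quat (- f7) (- i3 + f6) (- j3 - f5) 0) :> E.
  by rewrite /c; E_ring.
move=> dE [ii0 _ _ _ _ ii5 ii6 ii7] [jj0 _ _ _ _ jj5 jj6 jj7].
move=> [kk0 _ _ _ _ kk5 kk6 kk7].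
move=> [ij0 _ _ _ _ ij5 ij6 ij7] [jk0 _ _ _ _ jk5 jk6 jk7].
move=> [ki0 _ _ _ _ ki5 ki6 ki7].
(* In the second components of the relations for products such as i (i f) and i (j f), all terms
   cancel except a multiple of delta. *)
have [i60 i70 i50] : [/\ i6 = 0, i7 = 0 & i5 = 0].
  by clear -cancel_delta ii6 ii7 ij7; split; apply: cancel_delta; lra.
have [j50 j70 j60] : [/\ j5 = 0, j7 = 0 & j6 = 0].
  by clear -cancel_delta jj5 jj7 jk5; split; apply: cancel_delta; lra.
have [k50 k60 k70] : [/\ k5 = 0, k6 = 0 & k7 = 0].
  by clear -cancel_delta kk5 kk6 ki6; split; apply: cancel_delta; lra.
subst i5 i6 i7 j5 j6 j7 k5 k6 k7.
(* The real parts of the relations for i (j f), j (k f), k (i f) are skewness between i and j f and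
   so on; only the terms in c are left. *)
have [i40 j40 k40] : [/\ i4 = 0, j4 = 0 & k4 = 0].
  by clear -cancel_c ij0 jk0 ki0; split; apply: cancel_c; lra.
subst i4 j4 k4.
clear -dE cancel_delta.
move=> [_ _ _ _ g4 _ _ _] [_ _ _ _ g5 _ _ _] [_ _ _ _ g6 _ _ _].
(* Taken from the coefficient of f in the image of (i f)(j f) = - (k + delta k f) and its cyclic
   analogues. *)
have [f50 f60 f70] : [/\ f5 = 0, f6 = 0 & f7 = 0].
  by clear -cancel_delta g4 g5 g6; split; apply: cancel_delta; lra.
subst f5 f6 f7.
exists (Quat 0 (j3 / 2) (- i3 / 2) (i2 / 2)) => //; apply/lfunP => u.
rewrite E_adE !quat_adE dE; case: u => -[u0 u1 u2 u3] [u4 u5 u6 u7].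
by congr pair; congr Quat => /=; field.
Qed.

End E_derivations.

(** * Irreducible submodules *)

Lemma irreducible_line (R : fieldType) (L : lieAlgType R) (V : vectType R)
    (rho : L -> 'End(V)) (v : V) :
  v != 0 -> (forall d, rho d v = 0) -> irreducible_submodule rho <[v]>%VS.
Proof.
move=> v0 rho0; split=> [d||U Uv _].
- by rewrite limg_line rho0 -memvE mem0v.
- by rewrite -dimv_eq0 dim_vline v0.
have [->|U0] := eqVneq U 0%VS; [by left | right].
apply/eqP; rewrite eqEdim Uv dim_vline v0 lt0n.
by rewrite dimv_eq0.
Qed.

(** Carries irreducibility from [Der A] over to su(2) along the isomorphism in the last claim. *)
Lemma irreducible_submodule_comp (R : fieldType) (L L' : lieAlgType R)
    (V : vectType R) (rho : L -> 'End(V)) (phi : L' -> L) (W : {vspace V}) :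
  (forall d, exists d', phi d' = d) -> irreducible_submodule rho W ->
  irreducible_submodule (fun d => rho (phi d)) W.
Proof.
move=> phi_surj [Wsub W0 Wirr]; split=> [d||U UW Usub] //.
by apply: Wirr => // d; have [d' <-] := phi_surj d; exact: Usub.
Qed.

Section irreducible_imaginary.
Variables (R : realFieldType) (L : lieAlgType R) (V : vectType R).
(** The copy [e] of the quaternions is arbitrary so that one argument serves both span{i, j, k} and
    span{if, jf, kf}. *)
Variables (rho : L -> 'End(V)) (e : {linear quat R -> V}).
Hypothesis e_inj : injective e.
Hypothesis rho_comm : forall d, exists q,
  forall x, rho d (e x) = e (quat_comm q x).
Hypothesis comm_rho : forall q, quat_re q = 0 ->
  exists d, forall x, rho d (e x) = e (quat_comm q x).

Let W := <<[:: e quat_i; e quat_j; e quat_k]>>%VS.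

Lemma mem_imaginary b c d : e (Quat 0 b c d) \in W.
Proof.
have -> : e (Quat 0 b c d) = b *: e quat_i + c *: e quat_j + d *: e quat_k.
  by rewrite -!linearZ -!linearD; congr (e _); congr Quat => /=; ring.
by rewrite !memvD// memvZ// memv_span// !inE eqxx ?orbT.
Qed.

Lemma imaginaryP v :
  v \in W -> exists b c d, v = e (Quat 0 b c d).
Proof.
rewrite /W !span_cons span_nil addv0 => /memv_addP[_ /vlineP[b ->]].
case=> _ /memv_addP[_ /vlineP[c ->]] [_ /vlineP[d ->] ->] ->.
exists b, c, d; rewrite -!linearZ -!linearD; congr (e _).
by congr Quat => /=; ring.
Qed.

(* For v = b i + c j + d k, [ad i (ad j v)] = 4 b j and [ad k (ad j v)] = 4 d j. *)
Lemma irreducible_imaginary : irreducible_submodule rho W.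
Proof.
split=> [d||U UW Usub].
- have [q qE] := rho_comm d.
  apply/subvP => _ /memv_imgP[v /imaginaryP[b [c [d' ->]]] ->].
  rewrite qE; case: q {qE} => q0 q1 q2 q3.
  set x := quat_comm _ _.
  have -> : x = Quat 0 (quat_im_i x) (quat_im_j x) (quat_im_k x).
    by congr Quat; rewrite /x /=; ring.
  exact: mem_imaginary.
- apply/negP => /eqP W0; have := mem_imaginary 1 0 0; rewrite W0 memv0.
  rewrite -(linear0 e) => /eqP/e_inj[] /eqP.
  by rewrite oner_eq0.
have [->|U0] := eqVneq U 0%VS; [by left | right].
apply/eqP; rewrite eqEsubv UW /=.
have UC p x : quat_re p = 0 -> e x \in U -> e (quat_comm p x) \in U.
  move=> p0 xU; have [d dE] := comm_rho p0.
  by rewrite -dE; apply: (subvP (Usub d)); rewrite memv_img.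
have UZ a x y : y = a *: x -> e x \in U -> e y \in U.
  by move=> -> xU; rewrite linearZ memvZ.
(* Since [k, i] = 2 j, and cyclically, one basis vector in U brings in the other two. *)
have ij : e quat_i \in U -> e quat_j \in U.
  move/(UC quat_k _ erefl); apply: (UZ (1 / 2)).
  by congr Quat => /=; field.
have jk : e quat_j \in U -> e quat_k \in U.
  move/(UC quat_i _ erefl); apply: (UZ (1 / 2)).
  by congr Quat => /=; field.
have ki : e quat_k \in U -> e quat_i \in U.
  move/(UC quat_j _ erefl); apply: (UZ (1 / 2)).
  by congr Quat => /=; field.
suff iU : e quat_i \in U.
  apply/span_subvP => z; rewrite !inE => /or3P[]/eqP-> //; first exact: ij.
  exact/jk/ij.
have [b [c [d vE]]] := imaginaryP (subvP UW _ (memv_pick U)).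
have vU : e (Quat 0 b c d) \in U by rewrite -vE memv_pick.
have jU : (b != 0) || (d != 0) -> e quat_j \in U.
  case/orP=> [b0|d0].
    have := UC quat_i _ erefl (UC quat_j _ erefl vU).
    by apply: (UZ (1 / (4 * b))); congr Quat => /=; field.
  have := UC quat_k _ erefl (UC quat_j _ erefl vU).
  by apply: (UZ (1 / (4 * d))); congr Quat => /=; field.
have [/jU/jk/ki//|] := boolP ((b != 0) || (d != 0)).
rewrite negb_or !negbK => /andP[/eqP b0 /eqP d0]; apply/ki/jk.
(* What remains is v = c j, and v is nonzero because [vpick] vanishes only on the zero subspace. *)
have c0 : c != 0.
  apply: contra U0 => /eqP c0; rewrite -vpick0 vE b0 c0 d0.
  by rewrite -[Quat 0 0 0 0]/(0 : quat R) linear0.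
by apply: (UZ c^-1 _ _ _ vU); rewrite b0 d0; congr Quat => /=; field.
Qed.

End irreducible_imaginary.

(** * The decomposition of [E] into irreducible submodules *)

Section E_modules.
Variables (R : realType) (alpha delta : R).
Local Notation A := (E_algebra alpha delta : naAlgType R).
Hypotheses (delta0 : delta != 0) (alpha12 : alpha != 1 / 2).

Lemma E_Der_su2 :
  exists phi : {linear su R 2 -> Der A}, lie_isomorphism phi.
Proof.
have [phi phi_iso _] := su2_Der_isomorphism (@E_ad_linear _ alpha delta)
  (@E_ad_derivation _ alpha delta) (@E_ad_bracket _ alpha delta)
  (@E_ad_inj _ alpha delta)
  (fun d => @E_derivationP _ alpha delta d delta0 alpha12).
by exists phi.
Qed.

Lemma quat_Der_su2 :
  exists phi : {linear su R 2 -> Der (quat R)}, lie_isomorphism phi.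
Proof.
have [phi phi_iso _] := su2_Der_isomorphism (@quat_ad_linear R)
  (@quat_ad_derivation R) (@quat_ad_bracket R) (@quat_ad_inj R)
  (@quat_derivationP R).
by exists phi.
Qed.

Lemma E_DerP (d : Der A) :
  exists2 q, quat_re q = 0 & der_fun d = E_ad alpha delta q.
Proof. by case: d => d dD; apply: E_derivationP. Qed.

Fact inl_is_linear : linear (fun x : quat R => (x, 0) : A).
Proof. by move=> a x y; congr pair; rewrite /= ?scaler0 ?addr0. Qed.
Fact inr_is_linear : linear (fun x : quat R => (0, x) : A).
Proof. by move=> a x y; congr pair; rewrite /= ?scaler0 ?addr0. Qed.

Let inl : {linear quat R -> A} := HB.pack (fun x : quat R => (x, 0) : A)
  (GRing.isLinear.Build R (quat R) A *:%R _ inl_is_linear).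
Let inr : {linear quat R -> A} := HB.pack (fun x : quat R => (0, x) : A)
  (GRing.isLinear.Build R (quat R) A *:%R _ inr_is_linear).

Lemma E_neq0 (x y : quat R) : (x != 0) || (y != 0) -> (x, y) != 0 :> A.
Proof. by apply: contraTneq => -[-> ->]; rewrite eqxx. Qed.

Lemma irreducible_one :
  irreducible_submodule (@der_fun R A) <[E_of_quat 1 : A]>%VS.
Proof.
apply: irreducible_line => [|d]; first by rewrite E_neq0 ?oner_eq0.
have [q _ ->] := E_DerP d.
by rewrite E_adE !quat_adE /= !(mulr1, mul1r, mulr0, mul0r) !subrr.
Qed.

Lemma irreducible_f :
  irreducible_submodule (@der_fun R A) <[E_f : A]>%VS.
Proof.
apply: irreducible_line => [|d]; first by rewrite E_neq0 ?oner_eq0 ?orbT.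
have [q _ ->] := E_DerP d.
by rewrite E_adE !quat_adE /= !(mulr1, mul1r, mulr0, mul0r) !subrr.
Qed.

Lemma irreducible_ijk : irreducible_submodule (@der_fun R A)
  <<[:: E_of_quat quat_i : A; E_of_quat quat_j; E_of_quat quat_k]>>%VS.
Proof.
apply: (irreducible_imaginary (e := inl)) => [x y []//|d|q q0].
- have [q _ ->] := E_DerP d; exists q => x.
  by rewrite E_adE !quat_adE /= mulr0 mul0r subrr.
- exists (MkDer (E_ad_derivation alpha delta q)) => x.
  by rewrite E_adE !quat_adE /= mulr0 mul0r subrr.
Qed.

Lemma E_mul_f (x : quat R) : (E_of_quat x : A) ** E_f = (0, x).
Proof. by case: x => *; congr pair; congr Quat => /=; ring. Qed.

Lemma irreducible_ijkf : irreducible_submodule (@der_fun R A)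
  <<[:: (E_of_quat quat_i : A) ** E_f; (E_of_quat quat_j : A) ** E_f;
        (E_of_quat quat_k : A) ** E_f]>>%VS.
Proof.
rewrite !E_mul_f.
apply: (irreducible_imaginary (e := inr)) => [x y []//|d|q q0].
- have [q _ ->] := E_DerP d; exists q => x.
  by rewrite E_adE !quat_adE /= mulr0 mul0r subrr.
- exists (MkDer (E_ad_derivation alpha delta q)) => x.
  by rewrite E_adE !quat_adE /= mulr0 mul0r subrr.
Qed.

Lemma E_dim : \dim {:A} = 8%N.
Proof. by rewrite dimvf. Qed.

Let W1 : {vspace A} := <[E_of_quat 1]>%VS.
Let W2 : {vspace A} := <[E_f]>%VS.
Let W3 : {vspace A} :=
  <<[:: E_of_quat quat_i; E_of_quat quat_j; E_of_quat quat_k]>>%VS.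
Let W4 : {vspace A} :=
  <<[:: (E_of_quat quat_i : A) ** E_f; (E_of_quat quat_j : A) ** E_f;
        (E_of_quat quat_k : A) ** E_f]>>%VS.

Lemma E_decomposition : (W1 + W2 + W3 + W4)%VS = fullv.
Proof.
apply/eqP; rewrite eqEsubv subvf /=; apply/subvP => -[x y] _.
have -> : (x, y) = quat_re x *: E_of_quat 1 + quat_re y *: E_f
    + inl (Quat 0 (quat_im_i x) (quat_im_j x) (quat_im_k x))
    + inr (Quat 0 (quat_im_i y) (quat_im_j y) (quat_im_k y)) :> A.
  case: x y => [x0 x1 x2 x3] [y0 y1 y2 y3].
  by congr pair; congr Quat => /=; ring.
have W4E : W4 = <<[:: inr quat_i; inr quat_j; inr quat_k]>>%VS.
  by rewrite /W4 !E_mul_f.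
by rewrite !memv_add ?W4E ?mem_imaginary// memvZ// memv_line.
Qed.

(** The four subspaces span a space of dimension 8 and have dimension at most 1, 1, 3, 3, so the
    bounds are attained. The same count gives [E_direct]. *)
Lemma E_dims :
  [/\ \dim W1 = 1%N, \dim W2 = 1%N, \dim W3 = 3%N & \dim W4 = 3%N].
Proof.
have d1 : \dim W1 = 1%N by rewrite dim_vline E_neq0 ?oner_eq0.
have d2 : \dim W2 = 1%N by rewrite dim_vline E_neq0 ?oner_eq0 ?orbT.
have d3 : (\dim W3 <= 3)%N by apply: dim_span.
have d4 : (\dim W4 <= 3)%N by apply: dim_span.
have := E_dim; rewrite -E_decomposition => dW.
have leD (U V : {vspace A}) : (\dim (U + V) <= \dim U + \dim V)%N.
  by rewrite -dimv_sum_cap leq_addr.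
have := leD (W1 + W2 + W3)%VS W4; have := leD (W1 + W2)%VS W3.
have := leD W1 W2; rewrite dW d1 d2.
by split=> //; lia.
Qed.

Lemma E_direct : directv (W1 + W2 + W3 + W4).
Proof.
have [d1 d2 d3 d4] := E_dims.
by rewrite directvE /= E_decomposition E_dim d1 d2 d3 d4.
Qed.

End E_modules.

Theorem mainTheorem13 (R : realType) :
  (forall alpha delta : R, delta != 0 -> alpha != 1 / 2 ->
     let A : naAlgType R := E_algebra alpha delta in
     let one : A := E_of_quat 1 in
     let i : A := E_of_quat quat_i in
     let j : A := E_of_quat quat_j in
     let k : A := E_of_quat quat_k in
     let f : A := E_f in
     let W1 : {vspace A} := <[one]>%VS in
     let W2 : {vspace A} := <[f]>%VS in
     let W3 : {vspace A} := <<[:: i; j; k]>>%VS in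
     let W4 : {vspace A} := <<[:: i ** f; j ** f; k ** f]>>%VS in
     [/\ noncommutative_jordan A,
         lie_isomorphic (Der A) (Der (quat R)) /\
           lie_isomorphic (Der (quat R)) (su R 2),
         [/\ irreducible_submodule (@der_fun R A) W1,
             irreducible_submodule (@der_fun R A) W2,
             irreducible_submodule (@der_fun R A) W3 &
             irreducible_submodule (@der_fun R A) W4] /\
           (directv (W1 + W2 + W3 + W4) /\
            (W1 + W2 + W3 + W4)%VS = fullv) &
         1 / 2 < alpha -> (2 * alpha - 1) * delta ^+ 2 < 4 ->
           linear_division_algebra A]) /\
  (exists A : naAlgType R,
     [/\ noncommutative_jordan A, linear_division_algebra A,
         \dim {:A} = 8%N &
         exists2 phi : {linear su R 2 -> Der A}, lie_isomorphism phi &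
         exists W1 W2 W3 W4 : {vspace A},
           [/\ [/\ irreducible_submodule (fun d => der_fun (phi d)) W1,
                   irreducible_submodule (fun d => der_fun (phi d)) W2,
                   irreducible_submodule (fun d => der_fun (phi d)) W3 &
                   irreducible_submodule (fun d => der_fun (phi d)) W4],
               [/\ \dim W1 = 1%N, \dim W2 = 1%N, \dim W3 = 3%N &
                   \dim W4 = 3%N],
               directv (W1 + W2 + W3 + W4) &
               (W1 + W2 + W3 + W4)%VS = fullv]]).
Proof.
split=> [alpha delta delta0 alpha12 A one i j k f W1 W2 W3 W4|].
  have su2A := E_Der_su2 delta0 alpha12.
  split; first exact: E_noncommutative_jordan.
  - split; last exact/lie_isomorphic_sym/quat_Der_su2.
    exact: lie_isomorphic_trans (lie_isomorphic_sym su2A) (quat_Der_su2 R).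
  - split; last by split; [exact: E_direct | exact: E_decomposition].
    split; [exact: irreducible_one | exact: irreducible_f
           | exact: irreducible_ijk | exact: irreducible_ijkf].
  - exact: E_linear_division.
have d0 : 1 != 0 :> R := oner_neq0 R.
(* The example takes alpha = delta = 1, for which (2 alpha - 1) delta^2 = 1 < 4. *)
have a12 : 1 != 1 / 2 :> R by apply/eqP; lra.
have [phi phi_iso] := E_Der_su2 d0 a12.
exists (E_algebra 1 1); split.
- exact: E_noncommutative_jordan.
- by apply: E_linear_division; lra.
- exact: E_dim.
exists phi => //.
have phi_surj d : exists X, phi X = d.
  by case: phi_iso => -[psi _ psiK] _; exists (psi d).
exists <[E_of_quat 1]>%VS, <[E_f]>%VS.
exists <<[:: E_of_quat quat_i; E_of_quat quat_j; E_of_quat quat_k]>>%VS.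
exists <<[:: amul (E_of_quat quat_i) E_f; amul (E_of_quat quat_j) E_f;
             amul (E_of_quat quat_k) E_f]>>%VS.
split; [split | exact: E_dims | exact: E_direct | exact: E_decomposition].
- by apply: irreducible_submodule_comp => //; exact: irreducible_one.
- by apply: irreducible_submodule_comp => //; exact: irreducible_f.
- by apply: irreducible_submodule_comp => //; exact: irreducible_ijk.
- by apply: irreducible_submodule_comp => //; exact: irreducible_ijkf.
Qed.
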